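(* For even positive integers $n$, $$B_n^+(s,t,q)=\sum_{r=0}^{\frac n2-1}q^{\binom{2r+1}{2}}\binom{n}{2r+1}_qB_{n-2r-1}(s,t,q)(s-1)^r(t-1)^r+\sum_{r=1}^{\frac n2}q^{\binom{2r}{2}}\binom{n}{2r}_qB_{n-2r}(s,t,q)(s-1)^{r-1}(t-1)^r.$$ For odd positive integers $n$, $$B_n^+(s,t,q)=\sum_{r=0}^{\lfloor n/2\rfloor}q^{\binom{2r+1}{2}}\binom{n}{2r+1}_qB_{n-2r-1}(s,t,q)(s-1)^r(t-1)^r+\sum_{r=1}^{\lfloor n/2\rfloor}q^{\binom{2r}{2}}\binom{n}{2r}_qB_{n-2r}(s,t,q)(s-1)^{r}(t-1)^{r-1}.$$
   Context: $\mathfrak{B}_n$ is the group of permutations $\pi$ of $\{\pm1,\dots,\pm n\}$ with $\pi(-i)=-\pi(i)$; write $\pi_i=\pi(i)$ and set $\pi_0=0$. For $\pi\in\mathfrak{B}_n$: $\mathrm{edes}_B(\pi)$ (resp. $\mathrm{odes}_B(\pi)$) is the number of even (resp. odd) indices $i\in\{0,1,\dots,n-1\}$ with $\pi_i>\pi_{i+1}$. The type B inversion number is $$\mathrm{inv}_B(\pi)=|\{1\le i<j\le n:\pi_i>\pi_j\}|+|\{1\le i<j\le n:-\pi_i>\pi_j\}|+|\{1\le i\le n:\pi_i<0\}|.$$ $B_n(s,t,q)=\sum_{\pi\in\mathfrak{B}_n}s^{\mathrm{edes}_B(\pi)}t^{\mathrm{odes}_B(\pi)}q^{\mathrm{inv}_B(\pi)}$,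 with $B_0(s,t,q)=1$. $\mathfrak{B}_n^+=\{\pi\in\mathfrak{B}_n:\pi_n>0\}$ and $B_n^+(s,t,q)=\sum_{\pi\in\mathfrak{B}_n^+}s^{\mathrm{edes}_B(\pi)}t^{\mathrm{odes}_B(\pi)}q^{\mathrm{inv}_B(\pi)}$. $\binom{n}{k}_q$ is the Gaussian binomial coefficient. *)

(* Defs.v *)
From HB Require Import structures.
From mathcomp Require Import all_boot all_order all_algebra all_fingroup.
From mathcomp Require Import ring.

Set Implicit Arguments.
Unset Strict Implicit.
Unset Printing Implicit Defensive.

Import Order.TTheory GRing.Theory Num.Theory.
Local Open Scope ring_scope.

(* The pair (i, b) stands for the integer i + 1 if b = false and for
   -(i + 1) if b = true, so that signed_ord n represents {+-1, ..., +-n}. *)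
Definition signed_ord (n : nat) : finType := ('I_n * bool)%type.

Definition sval_int (n : nat) (x : signed_ord n) : int :=
  if x.2 then - (x.1.+1%:Z) else x.1.+1%:Z.

Definition sopp (n : nat) (x : signed_ord n) : signed_ord n := (x.1, ~~ x.2).

Lemma sval_int_inj (n : nat) : injective (@sval_int n).
Proof. by case=> [i []] [j []] //= [/ord_inj->]. Qed.

Lemma sval_int_opp (n : nat) (x : signed_ord n) :
  sval_int (sopp x) = - sval_int x.
Proof. by case: x => i []; rewrite /sval_int /= ?opprK. Qed.

Definition hyperoct (n : nat) : {set {perm signed_ord n}} :=
  [set p : {perm signed_ord n} | [forall x, p (sopp x) == sopp (p x)]].

Lemma hyperoct_group_set (n : nat) : group_set (hyperoct n).
Proof.
apply/group_setP; split=> [|p r].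
  by rewrite inE; apply/forallP=> x; rewrite !perm1.
rewrite !inE => /forallP hp /forallP hr; apply/forallP=> x.
by rewrite !permM (eqP (hp x)) (eqP (hr (p x))).
Qed.

Canonical hyperoct_group (n : nat) := Group (hyperoct_group_set n).

(* win p i is pi_i for 1 <= i <= n, and pi_0 = 0; indices beyond n, where the
   value is junk, never occur below. *)
Definition win (n : nat) (p : {perm signed_ord n}) (i : nat) : int :=
  if i is i'.+1 then
    if insub i' is Some j then sval_int (p (j : 'I_n, false)) else 0
  else 0.

Definition edesB (n : nat) (p : {perm signed_ord n}) : nat :=
  #|[set i : 'I_n | ~~ odd i && (win p i > win p i.+1)]|.

Definition odesB (n : nat) (p : {perm signed_ord n}) : nat :=
  #|[set i : 'I_n | odd i && (win p i > win p i.+1)]|.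

(* Since 'I_n starts at 0, indices i with 1 <= i <= n appear as i.+1. *)
Definition invB (n : nat) (p : {perm signed_ord n}) : nat :=
  (#|[set ij : 'I_n * 'I_n |
       (ij.1 < ij.2)%N && (win p ij.1.+1 > win p ij.2.+1)%R]|
   + #|[set ij : 'I_n * 'I_n |
       (ij.1 < ij.2)%N && (- win p ij.1.+1 > win p ij.2.+1)%R]|
   + #|[set i : 'I_n | (win p i.+1 < 0)%R]|)%N.

(* Polynomials in s, t, q are given by their values in commutative rings; the
   formal polynomials are the values at the indeterminates. *)

Definition weightB (R : comNzRingType) (s t q : R) (n : nat)
    (p : {perm signed_ord n}) : R :=
  s ^+ edesB p * t ^+ odesB p * q ^+ invB p.

Definition Bpoly (R : comNzRingType) (n : nat) (s t q : R) : R :=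
  \sum_(p in hyperoct n) weightB s t q p.

Definition Bplus (R : comNzRingType) (n : nat) (s t q : R) : R :=
  \sum_(p in hyperoct n | win p n > 0) weightB s t q p.

Lemma Bpoly0 (R : comNzRingType) (s t q : R) : Bpoly 0 s t q = 1.
Proof.
have all1 (p : {perm signed_ord 0}) : p = 1%g by apply/permP; case=> -[].
rewrite /Bpoly (big_pred1 1%g) => [|p]; last first.
  by rewrite (all1 p) /= eqxx group1.
have c1 (A : {set 'I_0}) : #|A| = 0%N by apply: eq_card0 => -[].
have c2 (A : {set 'I_0 * 'I_0}) : #|A| = 0%N by apply: eq_card0 => -[[]].
by rewrite /weightB /edesB /odesB /invB !c1 !c2 !mulr1.
Qed.

Definition qint (n : nat) : {poly int} := \sum_(i < n) 'X^i.

Definition qfact (n : nat) : {poly int} := \prod_(i < n) qint i.+1.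

(* The denominator is monic and the division exact, see qbinom_polyP. *)
Definition qbinom_poly (n k : nat) : {poly int} :=
  if (k <= n)%N then qfact n %/ (qfact k * qfact (n - k)) else 0.

Definition qbinom (R : comNzRingType) (n k : nat) (q : R) : R :=
  (map_poly intr (qbinom_poly n k)).[q].

Lemma qint_monic (n : nat) : qint n.+1 \is monic.
Proof.
rewrite /qint -[X in X \is monic](_ : \poly_(i < n.+1) 1 = _).
  by rewrite monicE lead_coef_poly // oner_eq0.
by rewrite poly_def; apply: eq_bigr => i _; rewrite scale1r.
Qed.

Lemma qfact_monic (n : nat) : qfact n \is monic.
Proof. by apply: monic_prod => i _; apply: qint_monic. Qed.

Lemma qbinom_polyP (n k : nat) : (k <= n)%N ->
  qbinom_poly n k * (qfact k * qfact (n - k)) = qfact n.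
Proof.
have qfactS m : qfact m.+1 = qfact m * qint m.+1 by rewrite /qfact big_ord_recr.
have qintD a b : qint (a + b) = qint a + 'X^a * qint b.
  rewrite /qint big_split_ord /= mulr_sumr; congr (_ + _).
  by apply: eq_bigr => i _; rewrite exprD.
have ex l a b : (a + b)%N = l ->
    exists c, c * (qfact a * qfact b) = qfact (a + b).
  elim: l a b => [|l IH] [|a] [|b] //.
  - by move=> _; exists 1; rewrite /qfact !big_ord0 !mul1r.
  - by move=> _; exists 1; rewrite {1}/qfact big_ord0 !mul1r.
  - by move=> _; exists 1; rewrite {2}/qfact big_ord0 mulr1 mul1r addn0.
  move=> e; have [|c hc] := IH a b.+1; first by case: e.
  have [|d hd] := IH a.+1 b; first by move: e; rewrite addnS => -[].
  exists (c + 'X^(a.+1) * d)%R.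
  have -> : qfact (a.+1 + b.+1) =
      qfact (a + b.+1) * qint a.+1 + 'X^(a.+1) * (qfact (a.+1 + b) * qint b.+1).
    by rewrite addSn qfactS -addSn qintD mulrDr -addSnnS mulrCA.
  by rewrite -hc -hd (qfactS a) (qfactS b); ring.
move=> lekn; rewrite /qbinom_poly lekn.
have [c] := ex _ _ _ (subnKC lekn); rewrite subnKC // => <-.
by rewrite Pdiv.IdomainMonic.mulpK // monicMl ?qfact_monic.
Qed.

(* Main.v *)
Require Import Defs.
From mathcomp Require Import all_boot all_order all_algebra all_fingroup.
From mathcomp Require Import ring zify.

(** The proof computes [Bplus] by inclusion-exclusion on the decreasing run that
    ends a signed permutation [p] of length [n].

    Give a descent at position [i] the weight [w_i], which is [s] or [t]
    according to the parity of [i].  Let [T j] be the sum over the [p] whose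
    letters [j+1, ..., n] are positive and decreasing, where only the positions
    [i < j] carry a weight, and let [E j] be the same sum with position [j] also
    weighted.  Then [E (n-1)] is [Bplus n].  A weight [w_j] at a descent and [1]
    elsewhere is [1 + (w_j - 1) * (descent at j)], and for such a [p] a descent at
    [j] says exactly that the decreasing run already starts at letter [j]; hence
    [E j = T j + (w_j - 1) E (j-1)] ([tail_sum_rec]).  At [j = 0] there is no
    descent, since [0] is followed by a positive letter, so [E 0 = T 0].
    Unrolling writes [Bplus n] as the sum over [k >= 1] of [T (n-k)] times
    [(w_(n-1) - 1) ... (w_(n-k+1) - 1)] ([tail_sum_expand]); these products
    alternate between [s] and [t], and splitting by the parity of [k] gives the
    two sums of the theorem.

    It remains to see that [T (n-k)] is [q^C(k,2) qbinom n k B_(n-k)].  Positive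
    signed permutations of length [n+1] (those with a positive last letter) are
    obtained exactly once by appending a letter [c+1] to one of length [n] and
    shifting the larger absolute values ([sum_ins]); this keeps the previous
    descents and adds [n - c] inversions ([invB_ins]).  Building the
    decreasing tail letter by letter turns [T] into an iterated sum of powers of
    [q], evaluated with the column sums of the Gaussian coefficients
    ([sum_qbinom]).  For the induction to go through, the tail is required to
    end above an arbitrary bound [a] instead of [0] ([tail_sumE]). *)

Set Implicit Arguments.
Unset Strict Implicit.
Unset Printing Implicit Defensive.

Import Order.TTheory GRing.Theory Num.Theory.
Local Open Scope ring_scope.

Local Arguments win : simpl never.

(** * Appending a positive last letter *)

Section Insertion.
Variable n : nat.
Implicit Types (p : {perm signed_ord n}) (c : 'I_n.+1).

Lemma win_ord (k : nat) (p : {perm signed_ord k}) (i : 'I_k) :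
  win p i.+1 = sval_int (p (i, false)).
Proof. by rewrite /win valK. Qed.

Definition slift c (x : signed_ord n) : signed_ord n.+1 := (lift c x.1, x.2).

Lemma slift_inj c : injective (slift c).
Proof.
case=> [i b] [j d] e; congr (_, _); last exact: (congr1 snd e).
exact: (lift_inj (congr1 fst e)).
Qed.

Definition ins_fun p c (y : signed_ord n.+1) : signed_ord n.+1 :=
  if unlift ord_max y.1 is Some j then slift c (p (j, y.2)) else (c, y.2).

Lemma ins_fun_inj p c : injective (ins_fun p c).
Proof.
case=> [i b] [j d]; rewrite /ins_fun /=.
case: unliftP => [i'|] ->; case: unliftP => [j'|] -> //=.
- by move/slift_inj/perm_inj => -[-> ->].
- by case=> /eqP; rewrite -val_eqE /= eq_sym (negPf (neq_bump _ _)).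
- by case=> /eqP; rewrite -val_eqE /= (negPf (neq_bump _ _)).
- by case=> ->.
Qed.

(** Appends the letter [c + 1] to the window of [p], after making room for it
    among the absolute values. *)
Definition ins p c : {perm signed_ord n.+1} := perm (@ins_fun_inj p c).

Lemma ins_slift p c x : ins p c (slift ord_max x) = slift c (p x).
Proof. by case: x => i b; rewrite permE /ins_fun /= liftK. Qed.

Lemma ins_max p c b : ins p c (ord_max, b) = (c, b).
Proof. by rewrite permE /ins_fun /= unlift_none. Qed.

Lemma ins_hyperoct p c : p \in hyperoct n -> ins p c \in hyperoct n.+1.
Proof.
rewrite !inE => /forallP hp; apply/forallP=> -[i b].
case: (unliftP ord_max i) => [j|] ->; last by rewrite /sopp /= !ins_max.
by rewrite /sopp /= !(ins_slift p c (_, _)) (eqP (hp (j, b))).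
Qed.

Lemma ins_inj : injective (fun pc : {perm signed_ord n} * 'I_n.+1 => ins pc.1 pc.2).
Proof.
case=> [p c] [p' c'] /= e.
have [ec] : (c, false) = (c', false) by rewrite -(ins_max p) e ins_max.
move: e; rewrite -{}ec => e; congr (_, _); apply/permP => x.
by apply: (@slift_inj c); rewrite -!ins_slift e.
Qed.

(** Deleting the last letter and closing the gap it leaves in the absolute values
    inverts [ins]. *)
Lemma ins_onto (r : {perm signed_ord n.+1}) c :
    r \in hyperoct n.+1 -> r (ord_max, false) = (c, false) ->
  exists2 p, p \in hyperoct n & r = ins p c.
Proof.
rewrite inE => /forallP hr rmax.
have rmaxb b : r (ord_max, b) = (c, b).
  by case: b => //; have := hr (ord_max, false); rewrite rmax => /eqP.
(* [unlift] never fails, as [gE] shows, so the default value is not reached. *)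
pose g (x : signed_ord n) : signed_ord n :=
  let y := r (slift ord_max x) in (odflt x.1 (unlift c y.1), y.2).
have gE x : slift c (g x) = r (slift ord_max x).
  rewrite /g /slift /=; case: unliftP => [j <-|e] /=; first by case: (r _).
  have /perm_inj [] : r (slift ord_max x) = r (ord_max, (r (slift ord_max x)).2).
    by rewrite rmaxb -e; case: (r _).
  by move/eqP; rewrite eq_sym (negPf (neq_bump _ _)).
have g_inj : injective g.
  by move=> x y e; apply/(@slift_inj ord_max)/(@perm_inj _ r); rewrite -!gE e.
exists (perm g_inj).
  rewrite inE; apply/forallP=> x; rewrite !permE; apply/eqP/(@slift_inj c).
  by rewrite gE -[RHS]/(sopp (slift c (g x))) gE -(eqP (hr _)).
apply/permP=> -[i b]; case: (unliftP ord_max i) => [j|] ->.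
  by rewrite (ins_slift _ _ (j, b)) permE gE.
by rewrite ins_max rmaxb.
Qed.

(** A signed permutation with positive last letter is [ins p c] for exactly one
    pair, by [ins_inj] and [ins_onto]. *)
Lemma sum_ins (R : comNzRingType) (F : {perm signed_ord n.+1} -> R) :
  \sum_(r in hyperoct n.+1 | 0 < win r n.+1) F r
    = \sum_(c < n.+1) \sum_(p in hyperoct n) F (ins p c).
Proof.
pose A := [set pc : {perm signed_ord n} * 'I_n.+1 | pc.1 \in hyperoct n].
pose h (pc : {perm signed_ord n} * 'I_n.+1) := ins pc.1 pc.2.
transitivity (\sum_(r in h @: A) F r); last first.
  rewrite big_imset => [|x y _ _ /ins_inj //].
  by rewrite exchange_big pair_big_dep; apply: eq_bigl => pc; rewrite inE andbT.
apply: eq_bigl => r; rewrite (win_ord r ord_max).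
apply/andP/imsetP => [[hr]|[[p c]]]; last first.
  by rewrite inE /= => hp ->; rewrite ins_max ins_hyperoct.
case e: (r _) => [c b]; rewrite /sval_int /=; case: b e => // e _.
by have [p hp ->] := ins_onto hr e; exists (p, c) => //; rewrite inE /= hp.
Qed.

(** The effect of [ins] on the letters of the window, as a function on all
    integers.  It fixes [0], so it also accounts for the conventional letter
    [pi_0]; being odd and increasing, it preserves every comparison that
    descents and inversions test. *)
Definition gap (c : nat) (x : int) : int :=
  if c%:Z < x then x + 1 else if x < - c%:Z then x - 1 else x.

Lemma gap_lt c : {mono gap c : x y / x < y}.
Proof. by move=> x y; rewrite /gap; do ![case: ifP => ?]; lia. Qed.

Lemma gapN c x : gap c (- x) = - gap c x.
Proof. by rewrite /gap; do ![case: ifP => ?]; lia. Qed.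

Lemma gap_lt0 c x : (gap c x < 0) = (x < 0).
Proof. by rewrite /gap; do ![case: ifP => ?]; lia. Qed.

Lemma lt_gap (c : nat) x : (c.+1%:Z < gap c x) = (c%:Z < x).
Proof. by rewrite /gap; do ![case: ifP => ?]; lia. Qed.

Lemma win_ins p c i : (i <= n)%N -> win (ins p c) i = gap c (win p i).
Proof.
case: i => [|i] lein; first by rewrite /win /gap; case: ifP => ?; lia.
rewrite (win_ord p (Ordinal lein)).
have -> : win (ins p c) i.+1 = sval_int (slift c (p (Ordinal lein, false))).
  rewrite -ins_slift -win_ord; congr (win _ _.+1).
  by rewrite /= /bump leqNgt lein.
by case: (p _) => [j []]; rewrite /slift /sval_int /gap /= /bump;
  do ![case: ifP => ?]; lia.
Qed.

Lemma win_ins_last p c : win (ins p c) n.+1 = c.+1%:Z.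
Proof. by rewrite (win_ord _ ord_max) ins_max. Qed.

End Insertion.

(** * Inversions created by the last letter *)

(** Grouping the pairs by their larger index isolates the contribution of the
    last letter. *)
Lemma invB_sum n (p : {perm signed_ord n}) :
  invB p = (\sum_(j < n) (\sum_(i < j)
      ((win p j.+1 < win p i.+1)%R + (win p j.+1 < - win p i.+1)%R)
    + (win p j.+1 < 0)%R))%N.
Proof.
have card_pairs (P : nat -> nat -> bool) :
    #|[set ij : 'I_n * 'I_n | (ij.1 < ij.2)%N && P ij.1 ij.2]|
      = (\sum_(j < n) \sum_(i < j) P i j)%N.
  rewrite -sum1dep_card -(pair_big_dep xpredT (fun i j : 'I_n => (i < j)%N && P i j)
    (fun _ _ => 1%N)) /= (exchange_big_dep xpredT) //=.
  apply: eq_bigr => j _; rewrite (big_ord_widen n (fun i => nat_of_bool (P i j))).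
    by rewrite big_mkcondr; apply: eq_bigr => i _; case: P.
  exact: ltnW.
rewrite /invB (card_pairs (fun i j => win p j.+1 < win p i.+1)).
rewrite (card_pairs (fun i j => win p j.+1 < - win p i.+1)).
rewrite -sum1dep_card [RHS]big_split /=; congr (_ + _)%N.
  by rewrite -big_split; apply: eq_bigr => j _; rewrite -big_split.
by rewrite big_mkcond; apply: eq_bigr => j _; case: ifP.
Qed.

Lemma hyperoct_abs_inj n (p : {perm signed_ord n}) :
  p \in hyperoct n -> injective (fun i : 'I_n => (p (i, false)).1).
Proof.
rewrite inE => /forallP hp i j e.
have pN : p (j, true) = sopp (p (j, false)) by rewrite -(eqP (hp _)).
have : p (i, false) = p (j, false) \/ p (i, false) = p (j, true).
  rewrite pN; move: e; rewrite /sopp.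
  by case: (p (i, false)) (p (j, false)) => [k []] [k' []] /= ->; auto.
by case=> /perm_inj [].
Qed.

(** At most one of the two conditions holds, and one does when the absolute value
    exceeds [c]; the absolute values are [1, ..., n] in some order. *)
Lemma sum_abs_win n (p : {perm signed_ord n}) (c : nat) : p \in hyperoct n ->
  (\sum_(i < n) ((c%:Z < win p i.+1)%R + (c%:Z < - win p i.+1)%R) = n - c)%N.
Proof.
move=> hp; transitivity (\sum_(i < n) (c <= (p (i, false)).1))%N.
  apply: eq_bigr => i _; rewrite win_ord /sval_int.
  by case: (p _) => [j []] /=; lia.
transitivity (\sum_(j < n) (c <= j))%N.
  by rewrite [RHS](reindex_inj (hyperoct_abs_inj hp)).
elim: (n) => [|k IH]; first by rewrite big_ord0.
by rewrite big_ord_recr /= IH; lia.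
Qed.

(** The new letter [c + 1] is positive and forms inversions with an earlier letter
    [x] when [x] or [- x] exceeds it, that is, when [x] has larger absolute value:
    [n - c] times. *)
Lemma invB_ins n (p : {perm signed_ord n}) (c : 'I_n.+1) : p \in hyperoct n ->
  invB (ins p c) = (invB p + (n - c))%N.
Proof.
move=> hp; rewrite !invB_sum big_ord_recr /= win_ins_last; congr (_ + _)%N.
  apply: eq_bigr => j _; rewrite (win_ins p c (ltn_ord j)) gap_lt0.
  congr (_ + _)%N; apply: eq_bigr => i _.
  rewrite (win_ins p c (ltn_trans (ltn_ord i) (ltn_ord j))).
  by rewrite -gapN !gap_lt.
rewrite addn0 -(sum_abs_win c hp); apply: eq_bigr => i _.
by rewrite (win_ins p c (ltn_ord i)) -gapN !lt_gap.
Qed.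

(** * Decreasing tails *)

(** The letters in positions [m + 1, ..., n], followed by [a], decrease. *)
Definition falls_above n (m a : nat) (p : {perm signed_ord n}) : bool :=
  all (fun i => (if i == n then a%:Z else win p i.+1) < win p i)
    (index_iota m.+1 n.+1).

Lemma falls_aboveS n m a (p : {perm signed_ord n}) : (m < n)%N ->
  falls_above m a p =
    ((if m.+1 == n then a%:Z else win p m.+2) < win p m.+1)
      && falls_above m.+1 a p.
Proof.
by move=> ltmn; rewrite /falls_above /index_iota !subSS -(subnSK ltmn).
Qed.

(** The appended letter [c + 1] takes over the role of the final bound: a shifted
    letter exceeds [c + 1] when the letter before the shift exceeds [c]. *)
Lemma falls_above_ins n m a (p : {perm signed_ord n}) (c : 'I_n.+1) :
  (m <= n)%N -> falls_above m a (ins p c) = (a <= c)%N && falls_above m c p.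
Proof.
move=> lemn; rewrite /falls_above /index_iota !subSS subSn // -[(n - m).+1]addn1 iotaD.
rewrite all_cat andbC; congr (_ && _).
  by rewrite /= addSn subnKC // eqxx win_ins_last andbT; lia.
apply: eq_in_all => i; rewrite mem_iota => hi.
have -> : (i == n.+1) = false by lia.
rewrite (@win_ins _ p c i); last by lia.
case: eqP => [->|ne]; first by rewrite win_ins_last lt_gap.
by rewrite win_ins ?gap_lt //; lia.
Qed.

Lemma falls_above_gt0 n m a (p : {perm signed_ord n}) : (m < n)%N ->
  falls_above m a p -> 0 < win p m.+1.
Proof.
move=> ltmn; have [k] := ubnP (n - m); elim: k m ltmn => // k IH m ltmn hk.
rewrite falls_aboveS // => /andP[+ hf]; case: eqP => [_|ne].
  exact: le_lt_trans.
by apply: lt_trans; apply: IH => //; lia.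
Qed.

Lemma falls_above_last n m a (p : {perm signed_ord n.+1}) : (m <= n)%N ->
  falls_above m a p -> 0 < win p n.+1.
Proof.
move=> lemn /allP hf; have /hf : n.+1 \in index_iota m.+1 n.+2.
  by rewrite mem_index_iota; lia.
by rewrite eqxx; apply: le_lt_trans.
Qed.

(** * Gaussian binomial coefficients *)

Lemma qfactS n : qfact n.+1 = qfact n * qint n.+1.
Proof. by rewrite /qfact big_ord_recr. Qed.

Lemma qintD a b : qint (a + b) = qint a + 'X^a * qint b.
Proof.
rewrite /qint big_split_ord /= mulr_sumr; congr (_ + _).
by apply: eq_bigr => i _; rewrite exprD.
Qed.

(** Multiplied by the monic polynomial [qfact k.+1 * qfact (n - k)], this is the
    splitting [qint n.+1 = qint (n - k) + 'X^(n - k) * qint k.+1]. *)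
Lemma qbinom_poly_pascal n k : (k <= n)%N ->
  qbinom_poly n.+1 k.+1 = qbinom_poly n k.+1 + 'X^(n - k) * qbinom_poly n k.
Proof.
move=> lekn.
have nz : qfact k.+1 * qfact (n - k) != 0.
  by rewrite monic_neq0 // monicMl ?qfact_monic.
apply: (mulIf nz); have := @qbinom_polyP n.+1 k.+1 lekn; rewrite subSS => ->.
have -> : (qbinom_poly n k.+1 + 'X^(n - k) * qbinom_poly n k)
            * (qfact k.+1 * qfact (n - k))
    = qbinom_poly n k.+1 * (qfact k.+1 * qfact (n - k))
      + 'X^(n - k) * qint k.+1 * (qbinom_poly n k * (qfact k * qfact (n - k))).
  by rewrite (qfactS k); ring.
rewrite qbinom_polyP // qfactS -{2}(subnK lekn) -addnS qintD mulrDr; congr (_ + _).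
  have [ltkn|] := ltnP k n; last first.
    move=> lenk; have -> : (n - k = 0)%N by lia.
    by rewrite /qbinom_poly ltnNge lenk /qint big_ord0 mulr0 mul0r.
  by rewrite -(qbinom_polyP ltkn) -(subnSK ltkn) (qfactS (n - _)); ring.
by ring.
Qed.

Section GaussianBinomial.
Variables (R : comNzRingType) (q : R).

Lemma qbinom_small n k : (n < k)%N -> qbinom n k q = 0.
Proof.
by move=> ltnk; rewrite /qbinom /qbinom_poly leqNgt ltnk /= rmorph0 horner0.
Qed.

Lemma qbinom0 n : qbinom n 0 q = 1.
Proof.
rewrite /qbinom (_ : qbinom_poly n 0 = 1) ?rmorph1 ?hornerC //.
apply: (mulIf (monic_neq0 (qfact_monic n))).
by rewrite mul1r -[RHS](qbinom_polyP (leq0n n)) subn0 /qfact big_ord0 mul1r.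
Qed.

(** The factor [q ^+ k] avoids the exponent [n - k], and makes the identity hold
    for all [n] and [k]. *)
Lemma qbinom_pascal n k :
  q ^+ k * qbinom n.+1 k.+1 q = q ^+ k * qbinom n k.+1 q + q ^+ n * qbinom n k q.
Proof.
have [lekn|ltnk] := leqP k n; last by rewrite !qbinom_small ?mulr0 ?addr0 //; lia.
rewrite {1}/qbinom qbinom_poly_pascal // rmorphD rmorphM rmorphXn /=.
by rewrite map_polyX hornerD hornerM hornerXn mulrDr mulrA -exprD subnKC.
Qed.

Lemma sum_qbinom n k :
  \sum_(d < n) q ^+ d * qbinom d k q = q ^+ k * qbinom n k.+1 q.
Proof.
elim: n => [|n IH]; first by rewrite big_ord0 qbinom_small ?mulr0.
by rewrite big_ord_recr /= IH qbinom_pascal.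
Qed.

End GaussianBinomial.

(** * Sums over decreasing tails *)

Lemma sum_even_odd (V : nmodType) n (f : nat -> V) :
  \sum_(k < n) f k = \sum_(r < uphalf n) f r.*2 + \sum_(r < n./2) f r.*2.+1.
Proof.
elim: n => [|n IH]; first by rewrite !big_ord0 addr0.
rewrite big_ord_recr /= {}IH uphalf_half.
have := odd_double_half n; case: (odd n); rewrite /= ?add1n ?add0n => en.
  by rewrite [X in _ = _ + X]big_ord_recr /= addrA en.
by rewrite [in RHS]big_ord_recr /= addrAC en.
Qed.

Section SignedEulerian.
Variables (R : comNzRingType) (s t q : R).

Definition desw (i : nat) : R := if odd i then t else s.

(** Descents count only in positions [0, ..., m - 1], inversions everywhere. *)
Definition prefix_weight n (m : nat) (p : {perm signed_ord n}) : R :=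
  (\prod_(i < m) (if win p i.+1 < win p i then desw i else 1)) * q ^+ invB p.

Lemma weightBE n (p : {perm signed_ord n}) :
  weightB s t q p = prefix_weight n p.
Proof.
rewrite /weightB /prefix_weight /edesB /odesB -!prodr_const.
rewrite [\prod_(i in _) s]big_mkcond [\prod_(i in _) t]big_mkcond -big_split /=.
congr (_ * _); apply: eq_bigr => i _; rewrite !inE /desw.
by case: odd; case: ifP; rewrite /= ?mulr1 ?mul1r.
Qed.

Lemma prefix_weightS n m (p : {perm signed_ord n}) :
  prefix_weight m.+1 p =
    prefix_weight m p * (if win p m.+1 < win p m then desw m else 1).
Proof. by rewrite /prefix_weight big_ord_recr /= mulrAC. Qed.

Lemma prefix_weight_ins n m (p : {perm signed_ord n}) (c : 'I_n.+1) :
  (m <= n)%N -> p \in hyperoct n ->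
  prefix_weight m (ins p c) = q ^+ (n - c) * prefix_weight m p.
Proof.
move=> lemn hp; rewrite /prefix_weight invB_ins // addnC exprD mulrCA.
congr (_ * (_ * _)); apply: eq_bigr => i _.
have ltin : (i < n)%N := leq_trans (ltn_ord i) lemn.
by rewrite (win_ins p c ltin) (win_ins p c (ltnW ltin)) gap_lt.
Qed.

(** For [l = m] these are the sums [T m], for [l = m + 1] the sums [E m] of the
    recursion, with the bound [a] on the last letter in addition. *)
Definition tail_sum n l m a : R :=
  \sum_(p in hyperoct n | falls_above m a p) prefix_weight l p.

Lemma tail_sum_ins n m a : (m <= n)%N ->
  tail_sum n.+1 m m a =
    \sum_(c < n.+1 | (a <= c)%N) q ^+ (n - c) * tail_sum n m m c.
Proof.
move=> lemn; rewrite /tail_sum.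
transitivity (\sum_(r in hyperoct n.+1 | 0 < win r n.+1)
    if falls_above m a r then prefix_weight m r else 0).
  rewrite -big_mkcondr; apply: eq_bigl => r; rewrite -andbA; congr (_ && _).
  by case: (boolP (falls_above m a r)) => [/falls_above_last->|]; rewrite ?andbF.
rewrite sum_ins [RHS]big_mkcond; apply: eq_bigr => c _.
rewrite mulr_sumr -big_mkcondr (eq_bigl (fun p => (p \in hyperoct n) &&
   ((a <= c)%N && falls_above m c p))); last first.
  by move=> p; rewrite falls_above_ins.
case: (a <= c)%N => /=; last by rewrite big1 // => p; rewrite andbF.
by apply: eq_bigr => p /andP[hp _]; rewrite prefix_weight_ins.
Qed.

Lemma tail_sum_nn n a : tail_sum n n n a = Bpoly n s t q.
Proof.
apply: eq_big => [p|p _]; last by rewrite weightBE.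
by rewrite /falls_above /index_iota subnn andbT.
Qed.

(** By induction on the length of the tail.  Appending [c + 1] contributes
    [q ^+ (n - c)]; with [d = n - c], the bound [a <= c] becomes
    [d < n.+1 - a], and the sum over [d] is that of [sum_qbinom]. *)
Lemma tail_sumE n m a : (m <= n)%N ->
  tail_sum n m m a = q ^+ 'C(n - m, 2) * qbinom (n - a) (n - m) q * Bpoly m s t q.
Proof.
elim: n a => [|n IH] a; rewrite leq_eqVlt => /orP[/eqP->|lemn] //.
- by rewrite subnn qbinom0 !mul1r tail_sum_nn.
- by rewrite subnn qbinom0 !mul1r tail_sum_nn.
rewrite tail_sum_ins // (reindex_inj rev_ord_inj) /= subSn // binS bin1 exprD.
have -> : q ^+ 'C(n - m, 2) * q ^+ (n - m) * qbinom (n.+1 - a) (n - m).+1 q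
    = q ^+ 'C(n - m, 2) * \sum_(d < n.+1 - a) q ^+ d * qbinom d (n - m) q.
  by rewrite sum_qbinom mulrA.
rewrite (big_ord_widen n.+1 (fun d => q ^+ d * qbinom d (n - m) q)); last first.
  exact: leq_subr.
rewrite [RHS]mulrAC mulr_sumr; apply: eq_big => [d|d _]; first by have := ltn_ord d; lia.
have -> : (n - (n.+1 - d.+1) = d)%N by have := ltn_ord d; lia.
rewrite IH //; have -> : (n - (n.+1 - d.+1) = d)%N by have := ltn_ord d; lia.
by ring.
Qed.

(** The tail falls from position [m + 1] on when it falls from position [m + 2] on
    and [m + 1] is a descent, so replacing the weight [desw m.+1] of that
    descent by [1 + (desw m.+1 - 1)] splits the sum. *)
Lemma tail_sum_rec n m : (m.+1 < n)%N ->
  tail_sum n m.+2 m.+1 0 =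
    tail_sum n m.+1 m.+1 0 + (desw m.+1 - 1) * tail_sum n m.+1 m 0.
Proof.
move=> ltmn; rewrite /tail_sum !big_mkcondr mulr_sumr -big_split /=.
apply: eq_bigr => p _; rewrite (falls_aboveS _ _ (ltnW ltmn)) (ltn_eqF ltmn).
rewrite prefix_weightS; case: falls_above; rewrite ?andbF ?mulr0 ?addr0 //.
by case: ifP => _ /=; ring.
Qed.

(** The first letter is positive, so position [0] is not a descent. *)
Lemma tail_sum_start n : (0 < n)%N -> tail_sum n 1 0 0 = tail_sum n 0 0 0.
Proof.
move=> n_gt0; apply: eq_bigr => p /andP[_ /(falls_above_gt0 n_gt0) p1].
by rewrite prefix_weightS (lt_gtF p1) mulr1.
Qed.

Lemma tail_sum_expand n m : (m < n)%N ->
  tail_sum n m.+1 m 0 =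
    \sum_(r < m.+1) tail_sum n (m - r) (m - r) 0 * \prod_(i < r) (desw (m - i) - 1).
Proof.
elim: m => [|m IH] ltmn.
  by rewrite big_ord1 big_ord0 mulr1 tail_sum_start.
rewrite tail_sum_rec // IH; last exact: ltnW.
rewrite [RHS]big_ord_recl big_ord0 mulr1 subn0; congr (_ + _).
rewrite mulr_sumr; apply: eq_bigr => r _; rewrite big_ord_recl /= subn0 mulrCA.
by congr (_ * _); rewrite /bump /= add1n subSS.
Qed.

(** The parities of [m], [m - 1], ... alternate, and [desw m.+1] is the weight at
    [m - 1], with the advantage of making sense for [m = 0]. *)
Lemma prod_desw m r : (r <= m.+1)%N ->
  \prod_(i < r) (desw (m - i) - 1) =
    (desw m - 1) ^+ uphalf r * (desw m.+1 - 1) ^+ r./2.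
Proof.
elim: r => [|r IH] ltrm; first by rewrite big_ord0 mulr1.
rewrite big_ord_recr /= IH; last exact: ltnW.
have -> : desw (m - r) = if odd r then desw m.+1 else desw m.
  by rewrite /desw oddB //=; case: odd; case: odd.
rewrite uphalf_half; case: (odd r); rewrite /= ?add0n ?add1n !exprS; ring.
Qed.

Lemma Bplus_expand m :
  Bplus m.+1 s t q =
    \sum_(k < m.+1) q ^+ 'C(k.+1, 2) * qbinom m.+1 k.+1 q * Bpoly (m - k) s t q
      * ((desw m - 1) ^+ uphalf k * (desw m.+1 - 1) ^+ k./2).
Proof.
transitivity (tail_sum m.+1 m.+1 m 0).
  rewrite /Bplus /tail_sum; apply: eq_big => [p|p _]; last by rewrite weightBE.
  by rewrite falls_aboveS // eqxx /falls_above /index_iota subnn andbT.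
rewrite tail_sum_expand //; apply: eq_bigr => k _.
have lekm : (k <= m)%N by rewrite -ltnS.
rewrite prod_desw ?tail_sumE ?subn0; try lia.
by have -> : (m.+1 - (m - k) = k.+1)%N by lia.
Qed.

End SignedEulerian.

Theorem theorem11 (R : comNzRingType) (s t q : R) (n : nat) (n_gt0 : (0 < n)%N) :
  (~~ odd n ->
    Bplus n s t q =
      \sum_(0 <= r < n./2)
        q ^+ 'C(r.*2.+1, 2) * qbinom n r.*2.+1 q * Bpoly (n - r.*2.+1) s t q
          * (s - 1) ^+ r * (t - 1) ^+ r
      + \sum_(1 <= r < n./2.+1)
        q ^+ 'C(r.*2, 2) * qbinom n r.*2 q * Bpoly (n - r.*2) s t q
          * (s - 1) ^+ r.-1 * (t - 1) ^+ r)
  /\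
  (odd n ->
    Bplus n s t q =
      \sum_(0 <= r < n./2.+1)
        q ^+ 'C(r.*2.+1, 2) * qbinom n r.*2.+1 q * Bpoly (n - r.*2.+1) s t q
          * (s - 1) ^+ r * (t - 1) ^+ r
      + \sum_(1 <= r < n./2.+1)
        q ^+ 'C(r.*2, 2) * qbinom n r.*2 q * Bpoly (n - r.*2) s t q
          * (s - 1) ^+ r * (t - 1) ^+ r.-1).
Proof.
case: n n_gt0 => // m _; rewrite Bplus_expand.
(* The term of index [k] comes from tails of [k + 1] letters. *)
rewrite (@sum_even_odd _ _ (fun k => q ^+ 'C(k.+1, 2) * qbinom m.+1 k.+1 q *
  Bpoly (m - k) s t q * ((desw s t m - 1) ^+ uphalf k * (desw s t m.+1 - 1) ^+ k./2))).
split=> om.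
  have om1 : odd m by move: om; rewrite /= negbK.
  have uE : uphalf m.+1 = m.+1./2 by rewrite uphalf_half (negPf om).
  rewrite uE big_add1 /= !big_mkord /desw /= om1 /=.
  congr (_ + _); apply: eq_bigr => r _.
    by rewrite uphalf_double doubleK subSS; ring.
  by rewrite doubleS /= uphalf_double doubleK subSS; ring.
have om0 : odd m = false by apply: negPf.
have uE : uphalf m.+1 = m.+1./2.+1 by rewrite uphalf_half om.
rewrite uE big_add1 /= !big_mkord /desw /= om0 /=.
congr (_ + _); apply: eq_bigr => r _.
  by rewrite uphalf_double doubleK subSS; ring.
by rewrite doubleS /= uphalf_double doubleK subSS; ring.
Qed.
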